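(* Let $\Omega$ be a set, let $L_\infty(\Omega)$ denote the space of bounded real functions on $\Omega$ with norm $\|f\|_{L_\infty(\Omega)}=\sup_{z\in\Omega}|f(z)|$, and let $\mathcal{F}\subset L_\infty(\Omega)$ be compact. Let $\{f_n\}_{n\ge0}\subset\mathcal{F}$, $\{z_n\}_{n\ge0}\subset\Omega$, $\{h_n\}_{n\ge0}$ and $\{\mathcal{I}_n\}_{n\ge0}$ be produced by the Empirical Interpolation Method for $\mathcal{F}$. Then there is a realization of the Natural Greedy Algorithm for $\mathcal{F}$ in $L_\infty(\Omega)$ which selects exactly the same elements $f_0,f_1,f_2,\dots$, namely the one using the norming functionals $F_{g_n}(f)=\operatorname{sgn}(g_n(z_n))\,f(z_n)$, and for this realization $$\mathcal{R}_n(f)=f-\mathcal{I}_n(f)\quad\text{for all } f\in\mathcal{F},\ n\ge0,\qquad\text{and}\qquad g_n=h_n\ \text{or}\ g_n=-h_n\quad\text{for all } n\ge0 .$$ In particular both methods produce the same approximating subspaces.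
   Context: Empirical Interpolation Method (EIM): $\mathcal{I}_0(f)=0$. At step $n=0,1,2,\dots$: choose $f_n\in\mathcal{F}$ maximizing $\|f-\mathcal{I}_n(f)\|_{L_\infty(\Omega)}$ over $f\in\mathcal{F}$; choose $z_n\in\Omega$ maximizing $|(f_n-\mathcal{I}_n(f_n))(z)|$ over $z\in\Omega$; put $h_n=\frac{f_n-\mathcal{I}_n(f_n)}{(f_n-\mathcal{I}_n(f_n))(z_n)}$; and for each $f$ define $\mathcal{I}_{n+1}(f)=\sum_{k=0}^{n}\beta_kh_k$, where $(\beta_k)_{k=0}^n$ solves $\sum_{k=0}^{n}\beta_kh_k(z_m)=f(z_m)$ for all $0\le m\le n$. It is part of the hypothesis that the method runs, i.e. these maxima are attained and the denominators are non-zero. Natural Greedy Algorithm (NGA) in a Banach space $\mathcal{X}$: a norming functional of $x\ne0$ is $F_x\in\mathcal{X}^*$ with $\|F_x\|=1$, $F_x(x)=\|x\|$ (not necessarily unique). Set $\mathcal{R}_0(f)=f$. For $n=0,1,2,\dots$: choose $f_n\in\mathcal{F}$ with $\|\mathcal{R}_n(f_n)\|=\max_{f\in\mathcal{F}}\|\mathcal{R}_n(f)\|$; put $g_n=\mathcal{R}_n(f_n)/\|\mathcal{R}_n(f_n)\|$; choose a norming functional $F_{g_n}$; put $r_n(f)=f-F_{g_n}(f)\,g_n$ and $\mathcal{R}_{n+1}=r_n\circ\mathcal{R}_n$. Any sequences produced by such choices form a realization. The approximating subspaces are $\operatorname{span}\{g_0,\dots,g_{n-1}\}$ for the NGA and $\operatorname{span}\{h_0,\dots,h_{n-1}\}$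 for the EIM. *)

(* Defs.v *)
From HB Require Import structures.
From mathcomp Require Import all_boot all_order all_algebra.
From mathcomp Require Import all_classical all_reals all_analysis.

Set Implicit Arguments.
Unset Strict Implicit.
Unset Printing Implicit Defensive.

Import Order.TTheory GRing.Theory Num.Theory.
Import numFieldNormedType.Exports.

Local Open Scope classical_set_scope.
Local Open Scope ring_scope.

Section Linfty_type.
Variables (Omega : Type) (R : realType).

Definition linf_pred : {pred Omega -> R} := mem (bounded_fun : set (Omega -> R)).

Record Linfty := MkLinfty {
  linf_fun :> Omega -> R;
  linf_funP : linf_fun \in linf_pred }.

HB.instance Definition _ := [isSub for linf_fun].
HB.instance Definition _ := [Choice of Linfty by <:].

Lemma linf_predP (f : Omega -> R) :
  f \in linf_pred <-> exists M, forall z, `|f z| <= M.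
Proof.
rewrite /linf_pred inE/=; split=> [/pinfty_ex_gt0[M _ fM]|[M fM]].
  by exists M => z; exact: fM.
apply: filterS (nbhs_pinfty_ge (num_real M)) => N /= MN z _ /=.
exact: le_trans MN.
Qed.

Lemma linf_submod : submod_closed (linf_pred : {pred Omega -> R}).
Proof.
split=> [|a u v /linf_predP[M uM] /linf_predP[N vN]]; apply/linf_predP.
  by exists 0 => z /=; rewrite normr0.
exists (`|a| * M + N) => z; apply: le_trans (ler_normD _ _) _.
by rewrite normrM lerD// ler_wpM2l.
Qed.

HB.instance Definition _ :=
  GRing.isSubmodClosed.Build R (Omega -> R) linf_pred linf_submod.
HB.instance Definition _ := [SubChoice_isSubLmodule of Linfty by <:].

(* If Omega is empty this is sup set0, which the library sets to 0. *)
Definition linf_norm (f : Linfty) : R := sup (range (fun z => `|f z|)).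

Lemma linf_norm_ub (f : Linfty) z : `|f z| <= linf_norm f.
Proof.
apply: ub_le_sup; last by exists z.
have /linf_predP[M fM] := linf_funP f.
by exists M => _ [w _ <-]; exact: fM.
Qed.

Lemma linf_norm_le (f : Linfty) M :
  0 <= M -> (forall z, `|f z| <= M) -> linf_norm f <= M.
Proof.
move=> M0 fM; rewrite /linf_norm.
have [->|/set0P E0] := eqVneq (range (fun z => `|f z|)) set0.
  by rewrite sup0.
by apply: ge_sup => // _ [w _ <-].
Qed.

Lemma linf_norm_ge0 (f : Linfty) : 0 <= linf_norm f.
Proof.
have [E0|/set0P[_ [z _ _]]] := eqVneq (range (fun z => `|f z|)) set0.
  by rewrite /linf_norm E0 sup0.
exact: le_trans (linf_norm_ub f z).
Qed.

Lemma linf_normD (f g : Linfty) :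
  linf_norm (f + g) <= linf_norm f + linf_norm g.
Proof.
apply: linf_norm_le; first by rewrite addr_ge0// linf_norm_ge0.
by move=> z; rewrite (le_trans (ler_normD _ _))// lerD// linf_norm_ub.
Qed.

Lemma linf_normZ (a : R) (f : Linfty) :
  linf_norm (a *: f) = `|a| * linf_norm f.
Proof.
have le_normZ (b : R) (g : Linfty) : linf_norm (b *: g) <= `|b| * linf_norm g.
  apply: linf_norm_le; first by rewrite mulr_ge0// linf_norm_ge0.
  by move=> z; rewrite normrM ler_wpM2l// linf_norm_ub.
apply/eqP; rewrite eq_le le_normZ/=.
have [->|a0] := eqVneq a 0; first by rewrite normr0 mul0r linf_norm_ge0.
have a0' : 0 < `|a| by rewrite normr_gt0.
rewrite -ler_pdivlMl// -normfV.
by rewrite -{1}(scalerK a0 f).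
Qed.

Lemma linf_norm_eq0 (f : Linfty) : linf_norm f = 0 -> f = 0.
Proof.
move=> f0; apply/val_inj/funext => z; apply/eqP.
by rewrite -normr_le0 -f0 linf_norm_ub.
Qed.

HB.instance Definition _ :=
  Lmodule_isNormed.Build R Linfty linf_normD linf_normZ linf_norm_eq0.

Lemma linf_normE (f : Linfty) : `|f| = sup (range (fun z => `|f z|)).
Proof. by []. Qed.

Lemma linf_complete (F : set_system Linfty) :
  ProperFilter F -> cauchy F -> cvg F.
Proof.
move=> FF /cauchyP FC; apply/cvg_ex.
have FCz z : exists l : R, (f z @[f --> F]) --> l.
  apply/cvg_ex; apply: cauchy_cvg; apply: cauchy_exP => e e0.
  have [g Fg] := FC _ e0.
  exists (g z); rewrite /fmap/nbhs/=; apply: (filterS _ Fg) => f /=.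
  rewrite -!ball_normE/=; apply: le_lt_trans.
  exact: (linf_norm_ub (g - f)).
have [l lP] := choice FCz.
have near_l e : 0 < e ->
    exists2 g : Linfty, F (ball g e) & forall z, `|g z - l z| <= e.
  move=> e0; have [g Fg] := FC _ e0; exists g => // z.
  rewrite distrC; apply/ler_addgt0Pr => d d0.
  have Fd : F [set f : Linfty | `|l z - f z| < d].
    exact: ((@cvgrPdist_lt _ _ _ F _ (fun f : Linfty => f z) (l z)).1 (lP z)).
  have [f [/= fd]] := filter_ex (filterI Fd Fg).
  rewrite -ball_normE/= => gf.
  rewrite -(subrK (f z) (l z)) -addrA (le_trans (ler_normD _ _))// [leLHS]addrC.
  apply: lerD; last exact: ltW.
  rewrite distrC; exact: le_trans (linf_norm_ub (g - f) z) (ltW gf).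
have lb : l \in linf_pred.
  have [g _ gl] := near_l 1 ltr01; apply/linf_predP.
  exists (`|g| + 1) => z.
  rewrite -(subrK (g z) (l z)) [_ + g z]addrC (le_trans (ler_normD _ _))// lerD//.
    exact: linf_norm_ub.
  by rewrite distrC.
exists (MkLinfty lb); apply/cvgrPdist_le => e e0.
have e20 : 0 < e / 2 by rewrite divr_gt0.
have [g Fg gl] := near_l _ e20.
apply: filterS Fg => f; rewrite -ball_normE/= => gf.
rewrite -(subrK g (MkLinfty lb)) -addrA (le_trans (ler_normD _ _))//.
rewrite [leRHS]splitr lerD//; last exact: ltW.
apply: linf_norm_le; first exact: ltW.
by move=> z /=; rewrite -normrN opprB; exact: gl.
Qed.

HB.instance Definition _ := Uniform_isComplete.Build Linfty linf_complete.
End Linfty_type.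


Section greedy.
Variables (R : realType) (X : completeNormedModType R).

Definition maximizes (T : Type) (A : set T) (phi : T -> R) (t : T) : Prop :=
  A t /\ forall s, A s -> phi s <= phi t.

Definition dual_norm (phi : {scalar X}) : R :=
  sup [set `|phi x| | x in [set x : X | `|x| <= 1]].

(* Continuity says that phi belongs to the dual space; the algebraic notion
   {scalar X} alone does not.  It also makes the supremum in dual_norm that of
   a set bounded above. *)
Definition norming_functional (x : X) (phi : {scalar X}) : Prop :=
  [/\ x != 0, continuous phi, dual_norm phi = 1 & phi x = `|x|].

Record is_NGA (F : set X) (f g : nat -> X) (phi : nat -> {scalar X})
    (Rn : nat -> X -> X) : Prop := {
  nga_init : forall u, Rn 0%N u = u;
  nga_select : forall n, maximizes F (fun u => `|Rn n u|) (f n);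
  nga_neq0 : forall n, Rn n (f n) != 0;
  nga_normalize : forall n, g n = `|Rn n (f n)|^-1 *: Rn n (f n);
  nga_norming : forall n, norming_functional (g n) (phi n);
  nga_step : forall n u, Rn n.+1 u = Rn n u - phi n (Rn n u) *: g n }.

Definition lspan (n : nat) (g : nat -> X) : set X :=
  [set v | exists a : 'I_n -> R, v = \sum_(k < n) a k *: g k].

End greedy.

(* The maps I n are constrained only on F, where the method evaluates them. *)
Record is_EIM (Omega : Type) (R : realType) (F : set (Linfty Omega R))
    (f : nat -> Linfty Omega R) (z : nat -> Omega) (h : nat -> Linfty Omega R)
    (I : nat -> Linfty Omega R -> Linfty Omega R) : Prop := {
  eim_init : forall u, F u -> I 0%N u = 0;
  eim_select : forall n, maximizes F (fun u => `|u - I n u|) (f n);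
  eim_point : forall n,
    maximizes [set: Omega] (fun w => `|(f n - I n (f n)) w|) (z n);
  eim_neq0 : forall n, (f n - I n (f n)) (z n) != 0;
  eim_normalize : forall n,
    h n = ((f n - I n (f n)) (z n))^-1 *: (f n - I n (f n));
  eim_interp : forall n u, F u -> exists beta : 'I_n.+1 -> R,
    (forall m : 'I_n.+1, \sum_(k < n.+1) beta k * h k (z m) = u (z m)) /\
    I n.+1 u = \sum_(k < n.+1) beta k *: h k }.

(* Main.v *)
Require Import Defs.
From HB Require Import structures.
From mathcomp Require Import all_boot all_order all_algebra.
From mathcomp Require Import all_classical all_reals all_analysis.

(** Writing [e n = f n - I n (f n)], interpolation makes [h n] vanish at every
    earlier node [z m], while [h n (z n) = 1] and [`|h n| = 1].  Hence Newton's
    form of the interpolation error, [r n.+1 u = r n u - r n u (z n) *: h n],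
    yields residuals that vanish at [z 0, ..., z n.-1] and differ from [u] by an
    element of the span of [h 0, ..., h n.-1]; as the system [h k (z m)] is
    unitriangular, [r n u = u - I n u].  Since [sg (g n (z n)) *: g n = h n] for
    [g n = sg (e n (z n)) *: h n], this recursion is also the one of the NGA. *)

Set Implicit Arguments.
Unset Strict Implicit.
Unset Printing Implicit Defensive.

Import Order.TTheory GRing.Theory Num.Theory.
Import numFieldNormedType.Exports.

Local Open Scope classical_set_scope.
Local Open Scope ring_scope.

Section evaluation.
Context {Omega : Type} {R : realType}.
Implicit Types (u v : Linfty Omega R) (w : Omega) (a : R).

Lemma linfDE u v w : (u + v) w = u w + v w. Proof. by []. Qed.
Lemma linfBE u v w : (u - v) w = u w - v w. Proof. by []. Qed.
Lemma linfZE a u w : (a *: u) w = a * u w. Proof. by []. Qed.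

Lemma linf_sumE (n : nat) (F : nat -> Linfty Omega R) w :
  (\sum_(k < n) F k) w = \sum_(k < n) F k w.
Proof.
by elim: n => [|n IH]; rewrite ?big_ord0// !big_ord_recr linfDE IH.
Qed.

Lemma linf_norm_attained u w :
  (forall w', `|u w'| <= `|u w|) -> `|u| = `|u w|.
Proof.
by move=> uw; apply/eqP; rewrite eq_le linf_norm_ub andbT linf_norm_le.
Qed.

(** Named so that a linear structure can be attached to it; with [a] a sign, this is the functional
    chosen by the NGA. *)
Definition scaled_eval a w u : R := a * u w.

Lemma scaled_eval_is_scalar a w : scalar (scaled_eval a w).
Proof. by move=> b u v; rewrite /scaled_eval linfDE linfZE mulrDr mulrCA. Qed.

HB.instance Definition _ a w :=
  GRing.isLinear.Build R (Linfty Omega R) R _ _ (scaled_eval_is_scalar a w).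

(** Evaluation at [w] is 1-Lipschitz for the sup norm. *)
Lemma scaled_eval_continuous a w : continuous (scaled_eval a w).
Proof.
move=> u; apply: (@cvgMl_tmp _ _ (nbhs u) _ (fun v : Linfty Omega R => v w)).
apply: (@cvgrPdist_lt _ R _ (nbhs u) _ _ (u w)).2 => e e0.
near=> v; apply: (le_lt_trans (linf_norm_ub (u - v) w)).
by near: v; exact: (@cvgr_dist_lt _ _ _ (nbhs u) _ id u cvg_id _ e0).
Unshelve. all: by end_near. Qed.

(** The sign has modulus 1, so the sup norm bounds the dual norm by 1; [u] itself lies in the unit
    ball and attains 1. *)
Lemma scaled_eval_norming u w : `|u| = 1 -> `|u w| = 1 ->
  norming_functional u (scaled_eval (Num.sg (u w)) w).
Proof.
move=> u1 uw1; have sg1 : `|Num.sg (u w)| = 1.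
  by rewrite normr_sg -normr_eq0 uw1 oner_eq0.
have uu : scaled_eval (Num.sg (u w)) w u = 1 by rewrite /scaled_eval -normrEsg.
split; last by rewrite u1.
- by rewrite -normr_eq0 u1 oner_eq0.
- exact: scaled_eval_continuous.
have ub1 : ubound [set `|scaled_eval (Num.sg (u w)) w x| |
    x in [set x : Linfty Omega R | `|x| <= 1]] 1.
  move=> _ [x /= x1 <-]; rewrite normrM sg1 mul1r.
  exact: le_trans (linf_norm_ub x w) x1.
have in1 : [set `|scaled_eval (Num.sg (u w)) w x| |
    x in [set x : Linfty Omega R | `|x| <= 1]] 1.
  by exists u; rewrite /= ?u1// uu normr1.
apply/eqP; rewrite eq_le ge_sup//=; last by exists 1.
by apply: ub_le_sup => //; exists 1.
Qed.

End evaluation.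

Lemma lspan_subset_scaled (R : realType) (X : completeNormedModType R)
    (g h : nat -> X) (a : nat -> R) (n : nat) :
  (forall k, g k = a k *: h k) -> lspan n g `<=` lspan n h.
Proof.
move=> gh _ [b ->]; exists (fun k => b k * a k).
by apply: eq_bigr => k _; rewrite gh scalerA.
Qed.

(** Forward substitution: equation [m] involves only [c 0], ..., [c m], and the earlier ones vanish
    by strong induction. *)
Lemma unitriangular_coef_eq0 (R : pzRingType) (M : nat -> nat -> R) (n : nat)
    (c : nat -> R) :
  (forall k, M k k = 1) -> (forall k m, (m < k)%N -> M k m = 0) ->
  (forall m, (m < n)%N -> \sum_(k < n) c k * M k m = 0) ->
  forall m, (m < n)%N -> c m = 0.
Proof.
move=> M1 M0 cM; elim/ltn_ind => m IH mn.
rewrite -(cM m mn) (bigD1 (Ordinal mn))//= M1 mulr1 big1 ?addr0// => k /eqP km.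
case: (ltngtP k m) => [lt_km|lt_mk|kE].
- by rewrite IH ?mul0r// (ltn_trans lt_km).
- by rewrite M0 ?mulr0.
- by case: km; exact: val_inj.
Qed.

Section newton.
Context {Omega : Type} {R : realType}.
Variables (z : nat -> Omega) (h : nat -> Linfty Omega R).

(** Defined on the whole space, since [is_NGA] prescribes [Rn] for every [u], whereas [I] is
    constrained on [F] only. *)
Fixpoint newton_residual (n : nat) (u : Linfty Omega R) : Linfty Omega R :=
  if n is m.+1 then newton_residual m u - newton_residual m u (z m) *: h m
  else u.

Lemma newton_residualS n u : newton_residual n.+1 u =
  newton_residual n u - newton_residual n u (z n) *: h n.
Proof. by []. Qed.

Lemma newton_residualE n u :
  newton_residual n u = u - \sum_(k < n) newton_residual k u (z k) *: h k.
Proof.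
elim: n => [|n IH]; first by rewrite big_ord0 subr0.
by rewrite big_ord_recr newton_residualS {1}IH opprD addrA.
Qed.

Hypothesis h_diag : forall n, h n (z n) = 1.
Hypothesis h_below : forall n m, (m < n)%N -> h n (z m) = 0.

(** Each update cancels the value at the new node and, as [h n] vanishes at the earlier nodes, keeps
    the zeros already there. *)
Lemma newton_residual_node n u m : (m < n)%N -> newton_residual n u (z m) = 0.
Proof.
elim: n => // n IH; rewrite ltnS newton_residualS linfBE linfZE.
rewrite leq_eqVlt => /predU1P[->|mn]; first by rewrite h_diag mulr1 subrr.
by rewrite IH// h_below// mulr0 subr0.
Qed.

(** Newton's coefficients and [beta] both interpolate [u], so their difference solves a homogeneous
    unitriangular system. *)
Lemma newton_residual_unique n (u : Linfty Omega R) (beta : 'I_n -> R) :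
  (forall m : 'I_n, \sum_(k < n) beta k * h k (z m) = u (z m)) ->
  newton_residual n u = u - \sum_(k < n) beta k *: h k.
Proof.
(* A successor bound is needed for [inord], which extends [beta] to all of [nat]. *)
case: n beta => [|n] beta betaP; first by rewrite big_ord0 subr0.
rewrite newton_residualE; congr (_ - _); apply: eq_bigr => k _; congr (_ *: _).
apply/eqP; rewrite -subr_eq0 -[k in beta k]inord_val; apply/eqP.
apply: (@unitriangular_coef_eq0 _ (fun k m => h k (z m)) n.+1
  (fun k => newton_residual k u (z k) - beta (inord k))) => // m mn.
rewrite (eq_bigr (fun k : 'I_n.+1 => newton_residual k u (z k) * h k (z m)
  - beta k * h k (z m))); last by move=> i _; rewrite inord_val mulrBl.
rewrite sumrB (betaP (Ordinal mn)) /=.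
(* A residual vanishing at [z m] means that the Newton sum takes the value [u (z m)] there. *)
have := newton_residual_node u mn; rewrite newton_residualE linfBE.
rewrite (linf_sumE _ (fun k => newton_residual k u (z k) *: h k)) => /subr0_eq ->.
by under eq_bigr do rewrite -linfZE; rewrite subrr.
Qed.

End newton.

Section eim.
Context {Omega : Type} {R : realType} {F : set (Linfty Omega R)}
  {f : nat -> Linfty Omega R} {z : nat -> Omega} {h : nat -> Linfty Omega R}
  {I : nat -> Linfty Omega R -> Linfty Omega R}.
Hypothesis eimP : is_EIM F f z h I.

Lemma eim_residual_node n u m :
  F u -> (m < n)%N -> (u - I n u) (z m) = 0.
Proof.
case: n => // n Fu mn; have [beta [betaP ->]] := eim_interp eimP n Fu.
rewrite linfBE -(betaP (Ordinal mn)) /=.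
rewrite (eq_bigr (fun k : 'I_n.+1 => beta (inord k) *: h k)); last first.
  by move=> k _; rewrite inord_val.
rewrite (linf_sumE _ (fun k => beta (inord k) *: h k)).
by under [X in _ - X]eq_bigr do rewrite linfZE inord_val; rewrite subrr.
Qed.

Lemma eim_basis_diag n : h n (z n) = 1.
Proof. by rewrite (eim_normalize eimP) linfZE mulVf// (eim_neq0 eimP). Qed.

Lemma eim_basis_below n m : (m < n)%N -> h n (z m) = 0.
Proof.
move=> mn; have [Ff _] := eim_select eimP n.
by rewrite (eim_normalize eimP) linfZE (eim_residual_node Ff mn) mulr0.
Qed.

Lemma eim_newton_residual n u : F u -> newton_residual z h n u = u - I n u.
Proof.
case: n => [|n] Fu; first by rewrite (eim_init eimP)// subr0.
have [beta [betaP ->]] := eim_interp eimP n Fu.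
exact: newton_residual_unique eim_basis_diag eim_basis_below _ _ _ betaP.
Qed.

Lemma eim_residual_norm n :
  `|f n - I n (f n)| = `|(f n - I n (f n)) (z n)|.
Proof.
by apply: linf_norm_attained => w; have [_] := eim_point eimP n; exact.
Qed.

Lemma eim_basis_norm n : `|h n| = 1.
Proof.
rewrite (eim_normalize eimP) normrZ eim_residual_norm normfV mulVf//.
by rewrite normr_eq0 (eim_neq0 eimP).
Qed.

End eim.

Theorem mainTheorem4 (R : realType) (Omega : Type) (F : set (Linfty Omega R))
    (f : nat -> Linfty Omega R) (z : nat -> Omega) (h : nat -> Linfty Omega R)
    (I : nat -> Linfty Omega R -> Linfty Omega R) :
  compact F ->
  is_EIM F f z h I ->
  exists (g : nat -> Linfty Omega R) (phi : nat -> {scalar Linfty Omega R})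
         (Rn : nat -> Linfty Omega R -> Linfty Omega R),
    [/\ is_NGA F f g phi Rn,
        forall n (u : Linfty Omega R), phi n u = Num.sg (g n (z n)) * u (z n),
        forall n u, F u -> Rn n u = u - I n u,
        forall n, g n = h n \/ g n = - h n
      & forall n, lspan n g = lspan n h].
Proof.
move=> _ eimP.
(* The EIM divides by the signed value at [z n], the NGA by its modulus, which is the norm; [s n] is
   the discrepancy. *)
pose s n := Num.sg ((f n - I n (f n)) (z n)).
pose g n := s n *: h n.
have ss n : s n * s n = 1.
  by rewrite -expr2 sqr_sg (eim_neq0 eimP).
have sn n : `|s n| = 1 by rewrite normr_sg (eim_neq0 eimP).
have gz n : g n (z n) = s n by rewrite linfZE (eim_basis_diag eimP) mulr1.
have Ff n : F (f n) by have [] := eim_select eimP n.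
have RnE := @eim_newton_residual _ _ _ _ _ _ _ eimP.
have sgg n : Num.sg (g n (z n)) = s n by rewrite gz sgr_id.
exists g, (fun n => scaled_eval (Num.sg (g n (z n))) (z n)), (newton_residual z h).
split=> //.
- split=> //.
  + move=> n; split=> // u Fu; rewrite !RnE//.
    by have [_] := eim_select eimP n; exact.
  + move=> n; rewrite RnE//; apply/eqP => e0.
    by have := eim_neq0 eimP n; rewrite e0 eqxx.
  + move=> n; rewrite RnE// (eim_residual_norm eimP) /g (eim_normalize eimP).
    rewrite scalerA; congr (_ *: _).
    (* The modulus is sign times value, and [s n] is its own inverse. *)
    by rewrite normrEsg invfM -/(s n) (mulr1_eq (ss n)).
  + move=> n; apply: scaled_eval_norming; last by rewrite gz.
    by rewrite normrZ sn (eim_basis_norm eimP) mulr1.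
  + move=> n u; rewrite newton_residualS; congr (_ - _).
    (* The sign in the functional and the one in [g n] cancel. *)
    by rewrite /= /scaled_eval sgg /g scalerA [_ * s n]mulrC mulrA ss mul1r.
- move=> n; rewrite /g /s; case: sgrP (eim_neq0 eimP n); rewrite ?eqxx// => _ _.
    by left; rewrite scale1r.
  by right; rewrite scaleN1r.
(* The same signs serve both inclusions, because [h k = s k *: g k] as well. *)
- move=> n; rewrite eqEsubset; split; apply: (@lspan_subset_scaled _ _ _ _ s) => k //.
  by rewrite /g scalerA ss scale1r.
Qed.
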